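(* Let $(\alpha,\epsilon),(\tilde\alpha,\tilde\epsilon),(\beta,\eta),(\tilde\beta,\tilde\eta)\in\mathbb{A}^{D-d,d}$. The super Krawtchouk polynomials satisfy the following orthogonality relations: $$\sum_{(\alpha,\epsilon)\in\mathbb{A}^{D-d,d}}\tilde p^{\alpha}\tilde q^{\epsilon}\,\frac{D!}{\alpha!}\,\mathcal{P}(\alpha,\epsilon,\tilde\alpha,\tilde\epsilon)\,\mathcal{P}(\alpha,\epsilon,\tilde\beta,\tilde\eta)=\delta_{\tilde\alpha,\tilde\beta}\,\delta_{\tilde\epsilon,\tilde\eta}\,\frac{p_0^{D-d}q_0^{d}}{D!}\,\frac{\tilde\alpha!}{p^{\tilde\alpha}q^{\tilde\epsilon}},$$ $$\sum_{(\tilde\alpha,\tilde\epsilon)\in\mathbb{A}^{D-d,d}}p^{\tilde\alpha}q^{\tilde\epsilon}\,\frac{D!}{\tilde\alpha!}\,\mathcal{P}(\alpha,\epsilon,\tilde\alpha,\tilde\epsilon)\,\mathcal{P}(\beta,\eta,\tilde\alpha,\tilde\epsilon)=\delta_{\alpha,\beta}\,\delta_{\epsilon,\eta}\,\frac{p_0^{D-d}q_0^{d}}{D!}\,\frac{\alpha!}{\tilde p^{\alpha}\tilde q^{\epsilon}}.$$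
   Context: Let $m,n\in\mathbb{N}=\mathbb{Z}_{\ge0}$, $D\in\mathbb{N}$. Multi-index notation: $|\alpha|=\sum_i\alpha_i$, $\alpha!=\prod_i\alpha_i!$, $a^{\beta}=\prod_i a_i^{\beta_i}$. Data. $\mathrm{K}=(p,\tilde p,U)$ with $p,\tilde p\in\mathbb{C}^{m+1}$ and $U=(u_{i,j})_{i,j=0}^m$ a complex matrix such that $p_0=\tilde p_0\neq0$, $u_{0,j}=u_{i,0}=1$ for all $i,j$, and $PU\tilde PU^{\mathsf t}=p_0I_{m+1}$ with $P=\mathrm{diag}(p)$, $\tilde P=\mathrm{diag}(\tilde p)$. Likewise $\Lambda=(q,\tilde q,V)$ with $q,\tilde q\in\mathbb{C}^{n+1}$, $V=(v_{i,j})_{i,j=0}^n$ complex, $q_0=\tilde q_0\ne0$, $v_{0,j}=v_{i,0}=1$, and $QV\tilde QV^{\mathsf t}=q_0I_{n+1}$ with $Q=\mathrm{diag}(q)$, $\tilde Q=\mathrm{diag}(\tilde q)$. (Hence all $p_i,\tilde p_i,q_j,\tilde q_j$ are nonzero.) Variables. $x_0,\dots,x_m$ are commuting variables; $\xi_0,\dots,\xi_n$ are anticommuting (Grassmann) variables, $\xi_i\xi_j=-\xi_j\xi_i$, $\xi_j^2=0$, commuting with all $x_k$. Products $\xi^{\epsilon}=\xi_0^{\epsilon_0}\cdots\xi_n^{\epsilon_n}$, and all products of odd elements over an index $i$, are taken in increasing order of index. Put $\mathbb{Z}_2=\{0,1\}$, $\mathbb{A}^D=\{(\alpha,\epsilon)\in\mathbb{N}^{m+1}\times\mathbb{Z}_2^{n+1}:|\alpha|+|\epsilon|=D\}$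 and $\mathbb{A}^{D-d,d}=\{(\alpha,\epsilon)\in\mathbb{A}^D:|\epsilon|=d\}$. Super Krawtchouk polynomials. For $(\tilde\alpha,\tilde\epsilon)\in\mathbb{A}^D$ the $\mathcal{P}(\alpha,\epsilon,\tilde\alpha,\tilde\epsilon)=\mathcal{P}(\alpha,\epsilon,\tilde\alpha,\tilde\epsilon;\mathrm{K},\Lambda,D)$ are defined by $$\prod_{i=0}^m\Big(\sum_{j=0}^m u_{i,j}x_j\Big)^{\tilde\alpha_i}\prod_{i=0}^n\Big(\sum_{j=0}^n v_{i,j}\xi_j\Big)^{\tilde\epsilon_i}=\sum_{(\alpha,\epsilon)\in\mathbb{A}^D}\frac{D!}{\alpha!}\,\mathcal{P}(\alpha,\epsilon,\tilde\alpha,\tilde\epsilon)\,x^\alpha\xi^\epsilon .$$ *)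

(* Defs.v *)
From HB Require Import structures.
From mathcomp Require Import all_boot all_order all_algebra.
From mathcomp Require Import mpoly.

Set Implicit Arguments.
Unset Strict Implicit.
Unset Printing Implicit Defensive.

Import GRing.Theory.
Local Open Scope ring_scope.

(* Free A-module on the subsets of 'I_n: the basis vector indexed by S is the
   product of the xi i, i in S, taken in increasing order (see xipowE). *)
Definition grassmann (A : comNzRingType) (n : nat) : Type :=
  {ffun {set 'I_n} -> A^o}.

HB.instance Definition _ (A : comNzRingType) (n : nat) :=
  GRing.Lmodule.copy (grassmann A n) {ffun {set 'I_n} -> A^o}.

Section Grassmann.
Variables (A : comNzRingType) (n : nat).
Implicit Types (f g h : grassmann A n) (S T W X : {set 'I_n}).

Definition gcoef f S : A := (f : {ffun {set 'I_n} -> A^o}) S.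

Definition gbasis S : grassmann A n := [ffun T : {set 'I_n} => (T == S)%:R].

(* Number of transpositions needed to sort the concatenation of the increasing
   enumerations of S and T. *)
Definition inversions S T : nat :=
  (\sum_(i in S) \sum_(j in T) (j < i))%N.

Definition gmul f g : grassmann A n :=
  [ffun S : {set 'I_n} => \sum_(T : {set 'I_n} | T \subset S)
     (-1) ^+ inversions T (S :\: T) * gcoef f T * gcoef g (S :\: T)].

Lemma gcoefP f g : (forall S, gcoef f S = gcoef g S) -> f = g.
Proof. by move=> e; apply/ffunP => S; apply: e. Qed.

Lemma gcoefD f g S : gcoef (f + g) S = gcoef f S + gcoef g S.
Proof. by rewrite /gcoef ffunE. Qed.

Lemma gcoefZ a f S : gcoef (a *: f) S = a * gcoef f S.
Proof. by rewrite /gcoef ffunE. Qed.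

Lemma gcoef0 S : gcoef 0 S = 0.
Proof. by rewrite /gcoef ffunE. Qed.

Lemma gcoef_sum I (r : seq I) (P : pred I) (F : I -> grassmann A n) S :
  gcoef (\sum_(i <- r | P i) F i) S = \sum_(i <- r | P i) gcoef (F i) S.
Proof.
by apply: (big_morph (gcoef^~ S)) => [f g|]; rewrite ?gcoefD ?gcoef0.
Qed.

Lemma gcoef_basis S T : gcoef (gbasis S) T = (T == S)%:R.
Proof. by rewrite /gcoef ffunE. Qed.

Lemma gcoefM f g S : gcoef (gmul f g) S =
  \sum_(T : {set 'I_n} | T \subset S)
     (-1) ^+ inversions T (S :\: T) * gcoef f T * gcoef g (S :\: T).
Proof. by rewrite /gcoef ffunE. Qed.

Lemma inversions0s S : inversions set0 S = 0%N.
Proof. by rewrite /inversions big_set0. Qed.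

Lemma inversionss0 S : inversions S set0 = 0%N.
Proof. by rewrite /inversions big1 // => i _; rewrite big_set0. Qed.

Lemma inversionsUl S T X : [disjoint S & T] ->
  inversions (S :|: T) X = (inversions S X + inversions T X)%N.
Proof.
move=> dST; rewrite /inversions -bigU //.
by apply: eq_bigl => i; rewrite !inE.
Qed.

Lemma inversionsUr S T X : [disjoint S & T] ->
  inversions X (S :|: T) = (inversions X S + inversions X T)%N.
Proof.
move=> dST; rewrite /inversions -big_split; apply: eq_bigr => i _ /=.
by rewrite -bigU //; apply: eq_bigl => j; rewrite !inE.
Qed.

Lemma gmulA : associative gmul.
Proof.
move=> f g h; apply: gcoefP => S; rewrite !gcoefM.
pose F T W := (-1) ^+ (inversions T (S :\: T) + inversions (W :\: T) (S :\: W))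
   * gcoef f T * gcoef g (W :\: T) * gcoef h (S :\: W) : A.
transitivity (\sum_(T : {set 'I_n} | T \subset S)
  \sum_(W : {set 'I_n} | (T \subset W) && (W \subset S)) F T W).
  apply: eq_bigr => T sTS; rewrite gcoefM big_distrr /=.
  rewrite (reindex_onto (fun W => W :\: T) (fun X => X :|: T)) /=; last first.
    move=> X; rewrite subsetD => /andP[_ dXT].
    by rewrite setDUl setDv setU0; apply/setDidPl.
  have eWT W : (W :\: T :|: T == W) = (T \subset W).
    apply/eqP/idP => [<-|sTW]; first exact: subsetUr.
    by rewrite setUC -{2}(setID W T) (setIidPr sTW).
  apply: eq_big => [W|W]; rewrite eWT.
    rewrite andbC; case sTW: (T \subset W) => //=.
    apply/idP/idP => [sWD|]; last exact: setSD.
    rewrite -(setID W T) subUset (setIidPr sTW) sTS.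
    exact: subset_trans sWD (subsetDl _ _).
  case/andP=> _ sTW; rewrite setDDl [T :|: _]setUC (eqP (_ : _ :\: _ :|: _ == W)) ?eWT //.
  rewrite /F exprD -!mulrA; congr (_ * _); rewrite mulrCA; congr (_ * _).
transitivity (\sum_(W : {set 'I_n} | W \subset S)
  \sum_(T : {set 'I_n} | T \subset W) F T W).
  rewrite (exchange_big_dep (fun W => W \subset S)) /=; last first.
    by move=> T W _ /andP[].
  apply: eq_bigr => W sWS; apply: eq_bigl => T.
  rewrite sWS andbT andbC; case sTW: (T \subset W) => //=.
  exact: subset_trans sTW sWS.
apply: eq_bigr => W sWS; rewrite gcoefM mulrAC big_distrr /=.
apply: eq_bigr => T sTW; rewrite /F.
have dTW : [disjoint T & W :\: T].
  by rewrite -setI_eq0; apply/eqP/setP => i; rewrite !inE; case: (i \in T).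
have dWS : [disjoint W :\: T & S :\: W].
  by rewrite -setI_eq0; apply/eqP/setP => i; rewrite !inE; case: (i \in W); rewrite ?andbF.
have -> : S :\: T = (W :\: T) :|: (S :\: W).
  apply/setP=> i; rewrite !inE; move/subsetP/(_ i): sWS; move/subsetP/(_ i): sTW.
  case: (i \in T); case: (i \in W); case: (i \in S) => //= h1 h2;
    by [have := h1 isT | have := h2 isT].
have -> : inversions W (S :\: W)
        = (inversions T (S :\: W) + inversions (W :\: T) (S :\: W))%N.
  by rewrite -inversionsUl // -{1}(setIidPr sTW) setID.
have E (a b c x y z : A) : a * b * c * x * y * z = b * c * z * (a * x * y).
  rewrite [RHS]mulrC !mulrA; congr (_ * _); rewrite -!mulrA; congr (_ * _).
  by rewrite [RHS]mulrA [RHS]mulrC -!mulrA.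
by rewrite inversionsUr // !exprD E.
Qed.

Lemma gmul1g : left_id (gbasis set0) gmul.
Proof.
move=> f; apply: gcoefP => S; rewrite gcoefM (bigD1 set0) ?sub0set //=.
rewrite gcoef_basis eqxx setD0 inversions0s expr0 !mul1r big1 ?addr0 // => T.
by case/andP=> _ /negPf nT; rewrite gcoef_basis nT mulr0 mul0r.
Qed.

Lemma gmulg1 : right_id (gbasis set0) gmul.
Proof.
move=> f; apply: gcoefP => S; rewrite gcoefM (bigD1 S) //=.
rewrite gcoef_basis setDv eqxx inversionss0 expr0 mul1r mulr1 big1 ?addr0 // => T.
case/andP=> sTS nT; rewrite gcoef_basis setD_eq0.
by rewrite (negPf (_ : ~~ (S \subset T))) ?mulr0 //; apply: contra nT => sST; rewrite eqEsubset sTS.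
Qed.

Lemma gmulDl : left_distributive gmul +%R.
Proof.
move=> f g h; apply: gcoefP => S; rewrite gcoefD !gcoefM -big_split.
by apply: eq_bigr => T _; rewrite gcoefD mulrDr mulrDl.
Qed.

Lemma gmulDr : right_distributive gmul +%R.
Proof.
move=> f g h; apply: gcoefP => S; rewrite gcoefD !gcoefM -big_split.
by apply: eq_bigr => T _; rewrite gcoefD mulrDr.
Qed.

Lemma gbasis_neq0 : gbasis set0 != 0.
Proof.
apply/eqP => /(congr1 (gcoef^~ set0)); rewrite gcoef_basis gcoef0 eqxx.
by apply/eqP/oner_neq0.
Qed.

HB.instance Definition _ := GRing.Zmodule_isNzRing.Build (grassmann A n)
  gmulA gmul1g gmulg1 gmulDl gmulDr gbasis_neq0.

Lemma gscaleAl (a : A) f g : a *: (f * g) = (a *: f) * g.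
Proof.
apply: gcoefP => S; rewrite gcoefZ !gcoefM big_distrr /=.
by apply: eq_bigr => T _; rewrite gcoefZ !mulrA [a * _]mulrC.
Qed.

HB.instance Definition _ :=
  GRing.Lmodule_isLalgebra.Build A (grassmann A n) gscaleAl.

Lemma gscaleAr (a : A) f g : a *: (f * g) = f * (a *: g).
Proof.
apply: gcoefP => S; rewrite gcoefZ !gcoefM big_distrr /=.
by apply: eq_bigr => T _; rewrite gcoefZ mulrCA.
Qed.

HB.instance Definition _ :=
  GRing.Lalgebra_isAlgebra.Build A (grassmann A n) gscaleAr.

Definition xi (i : 'I_n) : grassmann A n := gbasis [set i].

Definition xipow (e : {ffun 'I_n -> bool}) : grassmann A n :=
  \prod_(i < n) xi i ^+ e i.

Lemma gbasisM S T : gbasis S * gbasis T =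
  if [disjoint S & T] then (-1) ^+ inversions S T *: gbasis (S :|: T) else 0.
Proof.
apply: gcoefP => X; rewrite gcoefM.
case: ifPn => dST; last first.
  rewrite gcoef0 big1 // => Y sY; rewrite !gcoef_basis.
  case: eqP => [->|]; rewrite ?mulr0 ?mul0r // mulr1.
  case: eqP => [eT|]; rewrite ?mulr0 //; case/negP: dST.
  by rewrite -eT -setI_eq0; apply/eqP/setP => i; rewrite !inE; case: (i \in S).
rewrite gcoefZ gcoef_basis; case: (altP (X =P S :|: T)) => [->|nX].
  rewrite (bigD1 S) ?subsetUl //= big1 ?addr0 => [|Y /andP[_ /negPf nY]]; last first.
    by rewrite gcoef_basis nY mulr0 mul0r.
  have -> : (S :|: T) :\: S = T.
    by rewrite setDUl setDv set0U; apply/setDidPl; rewrite disjoint_sym.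
  by rewrite !gcoef_basis !eqxx !mulr1.
rewrite mulr0 big1 // => Y sY; rewrite !gcoef_basis.
case: eqP => [eY|]; rewrite ?mulr0 ?mul0r // mulr1.
case: eqP => [eT|]; rewrite ?mulr0 //; case/eqP: nX.
by rewrite -eT -eY -{1}(setID X Y) (setIidPr sY).
Qed.

Lemma xi_sqr i : xi i * xi i = 0.
Proof. by rewrite gbasisM disjoints1 set11. Qed.

Lemma xi_anticomm i j : xi i * xi j = - (xi j * xi i).
Proof.
have [->|nij] := eqVneq i j; first by rewrite xi_sqr oppr0.
rewrite !gbasisM !disjoints1 !inE [j == i]eq_sym nij /= setUC -scaleNr.
congr (_ *: _); rewrite /inversions !big_set1.
by case: ltngtP nij => [_|_|/val_inj ->] //=; rewrite ?eqxx // ?expr1 ?expr0 ?opprK.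
Qed.

Lemma xipowE (e : {ffun 'I_n -> bool}) : xipow e = gbasis [set i | e i].
Proof.
rewrite /xipow.
have: sorted ltn (map val (index_enum 'I_n)).
  by rewrite /index_enum -enumT val_enum_ord iota_ltn_sorted.
have -> : [set i | e i] = [set i in index_enum 'I_n | e i].
  by apply/setP => i; rewrite !inE mem_index_enum.
elim: (index_enum _) => [|i s IH] /= ss.
  by rewrite big_nil; congr gbasis; apply/setP => i; rewrite !inE.
rewrite big_cons IH ?(path_sorted ss) //.
have /allP lts := order_path_min ltn_trans ss.
have nis : i \notin s.
  by apply/negP => /(map_f val)/lts; rewrite /= ltnn.
case ei: (e i); last first.
  rewrite expr0 mul1r; congr gbasis; apply/setP => j; rewrite !inE.
  by case: eqP => // ->; rewrite ei !andbF.
rewrite expr1 gbasisM disjoints1 inE (negPf nis) /=.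
have -> : inversions [set i] [set j in s | e j] = 0%N.
  rewrite /inversions big_set1 big1 // => j; rewrite inE => /andP[js _].
  by have := lts _ (map_f val js) => /= /ltnW; rewrite leqNgt => /negPf ->.
rewrite scale1r; congr gbasis; apply/setP => j; rewrite !inE.
by case: eqP => // ->; rewrite ei.
Qed.

Lemma gcoef_xipow (e e' : {ffun 'I_n -> bool}) :
  gcoef (xipow e) [set i | e' i] = (e' == e)%:R.
Proof.
rewrite xipowE gcoef_basis; congr (nat_of_bool _)%:R.
apply/eqP/eqP => [/setP ee|-> //]; apply/ffunP => i.
by have := ee i; rewrite !inE.
Qed.

Lemma xipow_decomp f : 
  f = \sum_(e : {ffun 'I_n -> bool}) gcoef f [set i | e i] *: xipow e.
Proof.
apply: gcoefP => S; rewrite gcoef_sum.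
have -> : S = [set i | [ffun i => i \in S] i] by apply/setP => i; rewrite inE ffunE.
rewrite (bigD1 [ffun i => i \in S]) //= gcoefZ gcoef_xipow eqxx mulr1.
rewrite big1 ?addr0 // => e /negPf ne.
by rewrite gcoefZ gcoef_xipow eq_sym ne mulr0.
Qed.

End Grassmann.

Arguments xi A [n].
Arguments xipow A [n].

Record krawtchouk_data (C : fieldType) (m : nat) := KrawtchoukData {
  kp : 'rV[C]_m.+1;
  kpt : 'rV[C]_m.+1;
  kU : 'M[C]_m.+1;
  kp0_eq : kp 0 0 = kpt 0 0;
  kp0_neq0 : kp 0 0 != 0;
  kU_row0 : forall j, kU 0 j = 1;
  kU_col0 : forall i, kU i 0 = 1;
  kU_orth : diag_mx kp *m kU *m diag_mx kpt *m kU^T = (kp 0 0)%:M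
}.

Definition vpow (C : fieldType) (k : nat) (v : 'rV[C]_k) (b : 'I_k -> nat) : C :=
  \prod_(i < k) v 0 i ^+ b i.

Definition mfact (k : nat) (a : 'X_{1..k}) : nat := (\prod_(i < k) (a i)`!)%N.

Definition edeg (k : nat) (e : {ffun 'I_k -> bool}) : nat := (\sum_(i < k) e i)%N.

(* (a, e) \in A^D *)
Definition in_A (D k l : nat) (a : 'X_{1..k}) (e : {ffun 'I_l -> bool}) : bool :=
  (mdeg a + edeg e == D)%N.

(* (a, e) \in A^(D-d,d) *)
Definition in_Ad (D d k l : nat) (a : 'X_{1..k}) (e : {ffun 'I_l -> bool}) : bool :=
  in_A D a e && (edeg e == d).

Section SuperKrawtchouk.
Variables (C : numFieldType) (m n : nat).
Variables (K : krawtchouk_data C m) (L : krawtchouk_data C n).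
Implicit Types (a ta : 'X_{1..m.+1}) (e te : {ffun 'I_n.+1 -> bool}).

Local Notation G := (grassmann {mpoly C[m.+1]} n.+1).

(* The x-part is a scalar of the algebra G over the polynomial ring C[x]. *)
Definition genfun ta te : G :=
  (\prod_(i < m.+1) (\sum_(j < m.+1) kU K i j *: 'X_j) ^+ ta i)
  *: \prod_(i < n.+1) (\sum_(j < n.+1) (kU L i j)%:MP *: xi _ j) ^+ te i.

(* The coefficient of x^a xi^e in the generating function is D!/a! times P;
   see superkrawtchouk_expansion and superkrawtchouk_unique. *)
Definition superkrawtchouk (D : nat) a e ta te : C :=
  (mfact a)%:R / (D`!)%:R * (gcoef (genfun ta te) [set i | e i])@_a.

Lemma card_edeg e : #|[set i | e i]| = edeg e.
Proof.
rewrite -sum1dep_card /edeg big_mkcond /=; apply: eq_bigr => i _.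
by case: (e i).
Qed.

Lemma mfact_neq0 a : (mfact a)%:R != 0 :> C.
Proof.
by rewrite Num.Theory.pnatr_eq0 -lt0n prodn_gt0 // => i; rewrite fact_gt0.
Qed.

Lemma fact_neq0 D : (D`!)%:R != 0 :> C.
Proof. by rewrite Num.Theory.pnatr_eq0 -lt0n fact_gt0. Qed.

(* xi-degree k, with constant coefficients in x *)
Definition ghomog (k : nat) (g : G) : Prop :=
  forall S, gcoef g S \is 0.-homog /\ (#|S| <> k -> gcoef g S = 0).

Lemma ghomog1 : ghomog 0 1.
Proof.
move=> S; rewrite gcoef_basis; split=> [|/eqP]; last first.
  by rewrite cards_eq0 => /negPf ->.
by case: eqP => _; [apply: dhomog1 | apply: dhomog0].
Qed.

Lemma ghomogM k l g h : ghomog k g -> ghomog l h -> ghomog (k + l) (g * h).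
Proof.
move=> hg hh S; rewrite gcoefM; split=> [|nS].
  apply: rpred_sum => T _; rewrite -mulrA.
  case: (hg T) (hh (S :\: T)) => [gT _] [hT _].
  have gh : gcoef g T * gcoef h (S :\: T) \is 0.-homog.
    by have := dhomogM gT hT.
  by rewrite -signr_odd; case: odd; rewrite ?expr1 ?expr0 ?mulN1r ?mul1r ?rpredN.
rewrite big1 // => T sTS.
have [eT|/eqP nT] := eqVneq #|T| k; last first.
  by rewrite (hg T).2 // mulr0 mul0r.
rewrite (hh (S :\: T)).2 ?mulr0 // => eD; apply: nS.
by rewrite -(cardsID T S) (setIidPr sTS) eT eD.
Qed.

Lemma ghomog_lin (c : 'I_n.+1 -> C) : ghomog 1 (\sum_(j < n.+1) (c j)%:MP *: xi _ j).
Proof.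
move=> S; rewrite gcoef_sum; split=> [|nS].
  apply: rpred_sum => j _; rewrite gcoefZ gcoef_basis.
  case: eqP => _; last by rewrite mulr0; apply: dhomog0.
  by rewrite mulr1 -alg_mpolyC; apply/rpredZ/dhomog1.
rewrite big1 // => j _; rewrite gcoefZ gcoef_basis.
by case: eqP => [eS|]; rewrite ?mulr0 //; case: nS; rewrite eS cards1.
Qed.

Lemma ghomog_prod te :
  ghomog (edeg te) (\prod_(i < n.+1) (\sum_(j < n.+1) (kU L i j)%:MP *: xi _ j) ^+ te i).
Proof.
rewrite /edeg; elim/big_rec2: _ => [|i k g _ hg]; first exact: ghomog1.
apply: ghomogM => //; case: (te i); first by rewrite expr1; apply: ghomog_lin.
by rewrite expr0; apply: ghomog1.
Qed.

Lemma dhomog_lin ta :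
  \prod_(i < m.+1) (\sum_(j < m.+1) kU K i j *: 'X_j) ^+ ta i \is (mdeg ta).-homog.
Proof.
rewrite mdegE; elim/big_rec2: _ => [|i k g _ hg]; first exact: dhomog1.
apply: dhomogM => //.
have h1 : \sum_(j < m.+1) kU K i j *: 'X_j \is 1.-homog.
  apply: rpred_sum => j _; apply: rpredZ; rewrite dhomogX.
  by apply/eqP; rewrite /= mdeg1.
elim: (ta i) => [|s IH]; first by rewrite expr0 dhomog1.
by rewrite exprS; apply: (dhomogM h1 IH).
Qed.

Lemma genfun_homog D ta te a e : in_A D ta te -> ~~ in_A D a e ->
  (gcoef (genfun ta te) [set i | e i])@_a = 0.
Proof.
move=> /eqP hD nA; rewrite gcoefZ.
have [h0 h1] := ghomog_prod te [set i | e i].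
have [ee|/eqP ne] := eqVneq (edeg e) (edeg te); last first.
  by rewrite h1 ?mulr0 ?mcoeff0 // card_edeg.
have := dhomogM (dhomog_lin ta) h0; rewrite addn0 => hh.
apply: (dhomog_nemf_coeff hh); apply: contra nA => /eqP /= ea.
by rewrite /in_A -hD ee -ea.
Qed.

Lemma coef_sum D (Q : 'X_{1..m.+1} -> {ffun 'I_n.+1 -> bool} -> C) a e :
  (gcoef (\sum_(b : 'X_{1..m.+1 < D.+1}) \sum_(h : {ffun 'I_n.+1 -> bool} | in_A D b h)
     (((D`!)%:R / (mfact b)%:R * Q b h) *: 'X_[b]) *: xipow {mpoly C[m.+1]} h)
    [set i | e i])@_a
  = if in_A D a e then (D`!)%:R / (mfact a)%:R * Q a e else 0.
Proof.
rewrite gcoef_sum raddf_sum /=.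
transitivity (\sum_(b : 'X_{1..m.+1 < D.+1} | (b == a :> 'X_{1..m.+1}) && in_A D b e)
    (D`!)%:R / (mfact b)%:R * Q b e).
  rewrite [RHS]big_mkcond /=; apply: eq_bigr => b _.
  rewrite gcoef_sum raddf_sum /= big_mkcond (bigD1 e) //= big1 ?addr0; last first.
    move=> h /negPf nh; case: ifP => // _.
    by rewrite gcoefZ gcoef_xipow eq_sym nh mulr0 mcoeff0.
  case: ifP => _; rewrite ?andbF // andbT.
  rewrite gcoefZ gcoef_xipow eqxx mulr1 mcoeffZ mcoeffX.
  by case: eqP => _; rewrite ?mulr1 ?mulr0.
case: ifP => hA; last first.
  by rewrite big_pred0 // => b; case: eqP => //= ->; rewrite hA.
have lt : (mdeg a < D.+1)%N by rewrite ltnS -(eqP hA) leq_addr.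
rewrite (big_pred1 (BMultinom lt)) // => b /=.
by rewrite bmeqP /=; case: eqP => //= ->.
Qed.

Lemma superkrawtchouk_expansion D ta te : in_A D ta te ->
  genfun ta te =
  \sum_(a : 'X_{1..m.+1 < D.+1}) \sum_(e : {ffun 'I_n.+1 -> bool} | in_A D a e)
    (((D`!)%:R / (mfact a)%:R * superkrawtchouk D a e ta te) *: 'X_[a])
    *: xipow {mpoly C[m.+1]} e.
Proof.
move=> hA; apply: gcoefP => S; apply/mpolyP => a.
have -> : S = [set i | [ffun i => i \in S] i] by apply/setP => i; rewrite inE ffunE.
rewrite (coef_sum D (fun b h => superkrawtchouk D b h ta te)).
case: ifPn => [_|nA]; last exact: genfun_homog hA nA.
by rewrite /superkrawtchouk mulrA mulrA divfK ?mfact_neq0 // divff ?fact_neq0 // mul1r.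
Qed.

Lemma superkrawtchouk_unique D ta te
    (Q : 'X_{1..m.+1} -> {ffun 'I_n.+1 -> bool} -> C) :
  genfun ta te =
  \sum_(a : 'X_{1..m.+1 < D.+1}) \sum_(e : {ffun 'I_n.+1 -> bool} | in_A D a e)
    (((D`!)%:R / (mfact a)%:R * Q a e) *: 'X_[a]) *: xipow {mpoly C[m.+1]} e ->
  forall a e, in_A D a e -> Q a e = superkrawtchouk D a e ta te.
Proof.
move=> hQ a e hA; rewrite /superkrawtchouk hQ coef_sum hA.
by rewrite mulrA mulrA divfK ?fact_neq0 // divff ?mfact_neq0 // mul1r.
Qed.

End SuperKrawtchouk.

(* Main.v *)
Require Import Defs.
From mathcomp Require Import all_boot all_order all_algebra.
From mathcomp Require Import ring.
From mathcomp Require Import reals complex.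
From mathcomp Require Import mpoly.

(** Up to the factor a!/D!, the polynomial P(a, e, ta, te) is a product of two
    numbers: the coefficient of x^a in a product of linear forms l_i (rows of U)
    and the coefficient of xi^e in a product of odd linear forms lambda_i (rows
    of V).  So the weighted sum in the first relation is 1/D! times a product of
    two pairings, one on polynomials and one on the Grassmann algebra.

    On polynomials take the Fischer pairing, in which distinct monomials are
    orthogonal and x^a has norm pt^a a!.  Multiplication by x_j is adjoint to
    pt_j d/dx_j, so multiplication by a linear form l is adjoint to a derivation,
    which sends a linear form l' to the scalar <l, l'>.  The condition
    P U Pt U^T = p_0 I says that the rows of U are orthogonal for this scalar
    product, with norms p_0/p_i.  Moving the factors of one product of the l_i
    across the pairing one at a time differentiates the other product away, and
    shows that these products are again orthogonal, with norm
    ta! prod_i (p_0/p_i)^(ta_i): fischer_xmonom.  The Grassmann side is the same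
    computation with the contraction antiderivations in place of derivatives:
    gpair_ximonom, which is a form of the Cauchy-Binet formula.  Together they
    give the first relation, superkrawtchouk_row_orth.

    The second relation is the first one read backwards.  For fixed D and d, the
    first says that the square matrix of the P(a, e, ta, te) has a left inverse,
    obtained by transposing and rescaling it; that inverse is also a right
    inverse (orthogonality_dual). *)

Set Implicit Arguments.
Unset Strict Implicit.
Unset Printing Implicit Defensive.

Import GRing.Theory.
Local Open Scope ring_scope.

(** * The Fischer pairing on polynomials *)

Section FischerPairing.
Variables (C : comNzRingType) (n : nat) (w : 'I_n -> C).
Implicit Types (f g h : {mpoly C[n]}) (c : 'I_n -> C) (k : nat).

Definition fischer_weight (a : 'X_{1..n}) : C :=
  (\prod_(i < n) w i ^+ a i) * (mfact a)%:R.

(** Only exponents of degree less than [k] are summed, to have a finite index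
    set: the pairing of f and g is the value for all large [k], and keeping [k]
    explicit makes adjunction an exact identity (see [fischer_adjX]). *)
Definition fischer k f g : C :=
  \sum_(a : 'X_{1..n < k}) fischer_weight a * f@_a * g@_a.

Definition xform c : {mpoly C[n]} := \sum_(j < n) c j *: 'X_j.

(** The derivation adjoint to multiplication by [xform c]. *)
Definition xderiv c g : {mpoly C[n]} := \sum_(j < n) (w j * c j) *: g^`M(j).

(** The factor [(a j).+1] is the one produced by differentiating a monomial: this
    is what makes x_j adjoint to a multiple of d/dx_j. *)
Lemma fischer_weightS a j :
  fischer_weight (a + U_(j)) = w j * (a j).+1%:R * fischer_weight a.
Proof.
have h i : i != j -> (a + U_(j))%MM i = a i.
  by move=> nij; rewrite mnmDE mnm1E eq_sym (negPf nij) addn0.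
have hj : (a + U_(j))%MM j = (a j).+1 by rewrite mnmDE mnm1E eqxx addn1.
have -> : fischer_weight (a + U_(j)) = w j ^+ (a j).+1 * ((a j).+1)`!%:R *
    ((\prod_(i < n | i != j) w i ^+ a i) * (\prod_(i < n | i != j) (a i)`!)%N%:R).
  rewrite /fischer_weight /mfact !(bigD1 (P := xpredT) j) //= hj natrM mulrACA.
  by congr (_ * (_ * _%:R)); apply: eq_bigr => i /h ->.
rewrite /fischer_weight /mfact !(bigD1 (P := xpredT) j) //=.
by rewrite exprS factS !natrM; ring.
Qed.

Lemma fischerC k f g : fischer k f g = fischer k g f.
Proof. by apply: eq_bigr => a _; rewrite mulrAC. Qed.

Lemma fischerDl k f f' g : fischer k (f + f') g = fischer k f g + fischer k f' g.
Proof.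
by rewrite -big_split; apply: eq_bigr => a _; rewrite mcoeffD mulrDr mulrDl.
Qed.

Lemma fischerZl k b f g : fischer k (b *: f) g = b * fischer k f g.
Proof.
by rewrite big_distrr; apply: eq_bigr => a _; rewrite /= mcoeffZ; ring.
Qed.

Lemma fischer0l k g : fischer k 0 g = 0.
Proof. by rewrite -(scale0r 0) fischerZl mul0r. Qed.

Lemma fischer0r k f : fischer k f 0 = 0.
Proof. by rewrite fischerC fischer0l. Qed.

Lemma fischerZr k b f g : fischer k f (b *: g) = b * fischer k f g.
Proof. by rewrite fischerC fischerZl fischerC. Qed.

Lemma fischer_suml k I (r : seq I) (F : I -> {mpoly C[n]}) g :
  fischer k (\sum_(i <- r) F i) g = \sum_(i <- r) fischer k (F i) g.
Proof.
apply: (big_morph (fun f => fischer k f g)) => [f f'|]; first exact: fischerDl.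
exact: fischer0l.
Qed.

Lemma fischer_sumr k I (r : seq I) (F : I -> {mpoly C[n]}) f :
  fischer k f (\sum_(i <- r) F i) = \sum_(i <- r) fischer k f (F i).
Proof.
by rewrite fischerC fischer_suml; apply: eq_bigr => i _; rewrite fischerC.
Qed.

Lemma fischer_monom k b g :
  fischer k 'X_[b] g = if (mdeg b < k)%N then fischer_weight b * g@_b else 0.
Proof.
case: ifP => hb; last first.
  rewrite /fischer big1 // => a _; rewrite mcoeffX.
  by case: eqP => [e|]; rewrite ?mulr0 ?mul0r //; rewrite e bmdeg in hb.
rewrite /fischer (bigD1 (BMultinom hb)) //= mcoeffX eqxx mulr1 big1 ?addr0 // => a.
rewrite bmeqP /= => na.
by rewrite mcoeffX eq_sym (negPf na) mulr0 mul0r.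
Qed.

(** Multiplying by x_j raises degrees by one, hence the shift of the bound. *)
Lemma fischer_adjX k j f g :
  fischer k.+1 ('X_j * f) g = w j * fischer k f (g^`M(j)).
Proof.
elim/mpolyind: f => [|b a f _ _ IH]; first by rewrite mulr0 !fischer0l mulr0.
rewrite mulrDr !fischerDl IH mulrDr; congr (_ + _).
rewrite -scalerAr !fischerZl -mpolyXD addmC !fischer_monom mdegD mdeg1 addn1 ltnS.
case: ifP => _; last by rewrite !mulr0.
rewrite fischer_weightS mcoeff_deriv -mulr_natl; ring.
Qed.

Lemma fischer_adj k c f g :
  fischer k.+1 (xform c * f) g = fischer k f (xderiv c g).
Proof.
rewrite mulr_suml fischer_suml fischer_sumr; apply: eq_bigr => j _.
by rewrite -scalerAl fischerZl fischer_adjX fischerZr mulrCA mulrA.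
Qed.

Lemma xderivM c f g : xderiv c (f * g) = xderiv c f * g + f * xderiv c g.
Proof.
rewrite mulr_suml mulr_sumr -big_split; apply: eq_bigr => j _ /=.
by rewrite mderivM scalerDr -scalerAl -scalerAr.
Qed.

Lemma xderiv1 c : xderiv c 1 = 0.
Proof. by rewrite /xderiv big1 // => j _; rewrite -mpolyC1 mderivC scaler0. Qed.

Lemma xderiv_xform c c' : xderiv c (xform c') = (\sum_(j < n) w j * c j * c' j)%:MP.
Proof.
rewrite raddf_sum; apply: eq_bigr => j _ /=.
rewrite [mderiv j _]linear_sum (bigD1 j) //= big1 ?addr0 => [|i nij]; last first.
  by rewrite mderivZ mderivX mnm1E (negPf nij) scale0r scaler0.
by rewrite mderivZ mderivX mnm1E eqxx -{1}[U_(j)%MM]add0m addmK mpolyX0 scale1r scalerA alg_mpolyC.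
Qed.

Variables (I : eqType) (u : I -> 'I_n -> C) (gam : I -> C).
Hypothesis u_orth : forall i i',
  \sum_(j < n) w j * u i j * u i' j = (i == i')%:R * gam i.

Definition xmonom (s : seq I) (t : I -> nat) : {mpoly C[n]} :=
  \prod_(i <- s) xform (u i) ^+ t i.

Lemma xderiv_xformX i i' k :
  xderiv (u i) (xform (u i') ^+ k)
  = ((i == i')%:R * k%:R * gam i) *: xform (u i') ^+ k.-1.
Proof.
elim: k => [|k IH]; first by rewrite expr0 xderiv1 mulr0 mul0r scale0r.
rewrite exprS xderivM xderiv_xform u_orth mul_mpolyC IH -scalerAr.
case: k {IH} => [|k] /=; first by rewrite mulr0 mul0r scale0r addr0 mulr1.
rewrite -exprS -scalerDl; congr (_ *: _).
by rewrite [k.+2%:R]mulrSr; ring.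
Qed.

Lemma xderiv_xmonom i s t : i \notin s -> xderiv (u i) (xmonom s t) = 0.
Proof.
elim: s => [|i' s IH]; rewrite /xmonom ?big_nil ?xderiv1 // big_cons.
rewrite inE negb_or => /andP[/negPf ni /IH h].
by rewrite xderivM xderiv_xformX ni !mul0r scale0r -/(xmonom s t) h mul0r mulr0 addr0.
Qed.

(** One factor [xform (u i)] is moved across the pairing at a time.  On the other
    product its adjoint only sees the power of the same form, by orthogonality:
    it lowers the exponent [p'.+1] and yields the factor [p'.+1 * gam i], or
    yields 0 if that exponent was 0.  The bound on [t] alone is enough since the
    value is 0 when [t] and [t'] have different degrees. *)
Lemma fischer_xmonom k s t t' :
  uniq s -> (\sum_(i <- s) t i < k)%N ->
  fischer k (xmonom s t) (xmonom s t')
  = \prod_(i <- s) ((t i == t' i)%:R * (t i)`!%:R * gam i ^+ t i).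
Proof.
elim: s k => [|i s IH] k /=.
  rewrite /xmonom !big_nil => _ k0; rewrite -mpolyX0 fischer_monom mdeg0 k0.
  rewrite mcoeffX eqxx mulr1 /fischer_weight /mfact.
  by rewrite !big1 ?mulr1 // => i _; rewrite mnm0E.
case/andP=> nis us; rewrite /xmonom !big_cons -/(xmonom s t) -/(xmonom s t').
elim: (t i) (t' i) k => [|p IHp] [|p'] k /=.
- by rewrite !expr0 !mul1r => lt; rewrite IH // mulr1.
- case: k => // k _; rewrite expr0 mul1r fischerC exprS -mulrA fischer_adj.
  by rewrite xderiv_xmonom // fischer0r !mul0r.
- case: k => // k _; rewrite expr0 mul1r exprS -mulrA fischer_adj.
  by rewrite xderiv_xmonom // fischer0r !mul0r.
case: k => // k; rewrite addSn ltnS => lt.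
rewrite exprS -mulrA fischer_adj xderivM xderiv_xformX xderiv_xmonom // mulr0 addr0.
rewrite -scalerAl fischerZr eqxx mul1r /= IHp // eqSS.
case: eqP => [<-|_]; last by rewrite !mul0r mulr0.
by rewrite factS natrM exprS; ring.
Qed.

End FischerPairing.

(** * The pairing on the Grassmann algebra *)

Section GrassmannPairing.
Variables (A : comNzRingType) (n : nat) (w : 'I_n -> A).
Implicit Types (f g h : grassmann A n) (c : 'I_n -> A) (S T : {set 'I_n}).

Definition gpair f g : A :=
  \sum_(S : {set 'I_n}) (\prod_(i in S) w i) * gcoef f S * gcoef g S.

(** The left derivative with respect to xi_j: the sign is the one needed to bring
    xi_j to the front of a sorted monomial. *)
Definition contract (j : 'I_n) g : grassmann A n :=
  [ffun S : {set 'I_n} => if j \in S then 0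
     else (-1) ^+ inversions [set j] S * gcoef g (j |: S)].

Definition xiform c : grassmann A n := \sum_(j < n) c j *: xi A j.

(** The antiderivation adjoint to left multiplication by [xiform c]. *)
Definition xicontract c g : grassmann A n :=
  \sum_(j < n) (w j * c j) *: contract j g.

Lemma gcoef_contract j g S : gcoef (contract j g) S =
  if j \in S then 0 else (-1) ^+ inversions [set j] S * gcoef g (j |: S).
Proof. by rewrite /gcoef ffunE. Qed.

Lemma gcoef_xiM j g S : gcoef (xi A j * g) S =
  if j \in S then (-1) ^+ inversions [set j] (S :\ j) * gcoef g (S :\ j) else 0.
Proof.
rewrite gcoefM; case: ifP => jS.
  rewrite (bigD1 [set j]) ?sub1set //= gcoef_basis eqxx mulr1 big1 ?addr0 // => T.
  by case/andP=> _ /negPf nT; rewrite gcoef_basis nT mulr0 mul0r.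
rewrite big1 // => T sTS; rewrite gcoef_basis.
by case: eqP sTS => [->|]; rewrite ?sub1set ?jS // mulr0 mul0r.
Qed.

Lemma inversions_set1U i j S : i \notin S ->
  inversions [set j] (i |: S) = ((i < j) + inversions [set j] S)%N.
Proof.
by move=> niS; rewrite inversionsUr ?disjoints1 // /inversions !big_set1.
Qed.

(** The canonical anticommutation relation.  For [i != j] the two sides differ by
    the sign of exchanging i and j, as exactly one of i < j and j < i holds. *)
Lemma contract_xiM i j g :
  contract j (xi A i * g) = (i == j)%:R *: g - xi A i * contract j g.
Proof.
apply: gcoefP => S.
rewrite gcoefD gcoefZ -[- (_ * _)]scaleN1r gcoefZ gcoef_contract !gcoef_xiM.
rewrite gcoef_contract !inE.
have [->|nij] := eqVneq i j.
  rewrite /=; case: ifPn => jS.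
    by rewrite mul1r setD1K // mulrA -expr2 sqrr_sign mul1r mulN1r subrr.
  by rewrite mulr0 addr0 setU1K // mulrA -expr2 sqrr_sign.
rewrite mul0r add0r /=.
case: (boolP (j \in S)) => jS; first by case: ifP; rewrite !mulr0.
case: ifP => iS; last by rewrite !mulr0.
have -> : (j |: S) :\ i = j |: (S :\ i).
  apply/setP=> k; rewrite !inE; case: (k =P i) => //= ->; by rewrite (negPf nij).
have jSi : j \notin S :\ i by rewrite !inE (negPf jS) andbF.
rewrite (inversions_set1U _ jSi) -{1}(setD1K iS) inversions_set1U ?setD11 //.
rewrite !exprD mulrA [in RHS]mulrA [in RHS]mulrA mulrA; congr (_ * _).
case: ltngtP nij => [_|_|/val_inj ->]; rewrite ?eqxx // => _; rewrite expr0 expr1; ring.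
Qed.

Lemma contract1 j : contract j 1 = 0.
Proof.
apply: gcoefP => S; rewrite gcoef_contract gcoef0 gcoef_basis.
case: ifP => // _; case: eqP => [/setP/(_ j)|]; rewrite ?mulr0 //.
by rewrite !inE eqxx.
Qed.

Lemma gpairC f g : gpair f g = gpair g f.
Proof. by apply: eq_bigr => S _; rewrite mulrAC. Qed.

Lemma gpairDl f f' g : gpair (f + f') g = gpair f g + gpair f' g.
Proof.
by rewrite -big_split; apply: eq_bigr => S _; rewrite gcoefD mulrDr mulrDl.
Qed.

Lemma gpairZl a f g : gpair (a *: f) g = a * gpair f g.
Proof.
by rewrite big_distrr; apply: eq_bigr => S _; rewrite /= gcoefZ; ring.
Qed.

Lemma gpair0l g : gpair 0 g = 0.
Proof. by rewrite -(scale0r 0) gpairZl mul0r. Qed.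

Lemma gpair0r f : gpair f 0 = 0.
Proof. by rewrite gpairC gpair0l. Qed.

Lemma gpairZr a f g : gpair f (a *: g) = a * gpair f g.
Proof. by rewrite gpairC gpairZl gpairC. Qed.

Lemma gpair_suml I (r : seq I) (F : I -> grassmann A n) g :
  gpair (\sum_(i <- r) F i) g = \sum_(i <- r) gpair (F i) g.
Proof.
apply: (big_morph (fun f => gpair f g)) => [f f'|]; first exact: gpairDl.
exact: gpair0l.
Qed.

Lemma gpair_sumr I (r : seq I) (F : I -> grassmann A n) f :
  gpair f (\sum_(i <- r) F i) = \sum_(i <- r) gpair f (F i).
Proof.
by rewrite gpairC gpair_suml; apply: eq_bigr => i _; rewrite gpairC.
Qed.

Lemma gpair_adj_xi j f g : gpair (xi A j * f) g = w j * gpair f (contract j g).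
Proof.
rewrite /gpair big_distrr /= (bigID (fun S => j \in S)) /= addrC big1 ?add0r; last first.
  by move=> S /negPf jS; rewrite gcoef_xiM jS mulr0 mul0r.
rewrite [RHS](bigID (fun S => j \in S)) /= [X in _ = X + _]big1 ?add0r; last first.
  by move=> S jS; rewrite gcoef_contract jS !mulr0.
rewrite (reindex_onto (fun S => j |: S) (fun S => S :\ j)) /=; last first.
  by move=> S; apply: setD1K.
have e S : (j \in j |: S) && ((j |: S) :\ j == S) = (j \notin S).
  rewrite setU11 /=; apply/eqP/idP => [<-|]; first by rewrite setD11.
  exact: setU1K.
apply: eq_big => [|S]; first exact: e.
rewrite e => jS; rewrite gcoef_xiM gcoef_contract (negPf jS) setU11 setU1K //.
by rewrite big_setU1 //=; ring.
Qed.

Lemma gpair_adj c f g : gpair (xiform c * f) g = gpair f (xicontract c g).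
Proof.
rewrite mulr_suml gpair_suml gpair_sumr; apply: eq_bigr => j _.
by rewrite -scalerAl gpairZl gpair_adj_xi gpairZr mulrCA mulrA.
Qed.

Lemma contractD j f g : contract j (f + g) = contract j f + contract j g.
Proof.
apply: gcoefP => S; rewrite gcoefD !gcoef_contract gcoefD.
by case: ifP; rewrite ?addr0 // mulrDr.
Qed.

Lemma contractZ j a f : contract j (a *: f) = a *: contract j f.
Proof.
apply: gcoefP => S; rewrite gcoefZ !gcoef_contract gcoefZ.
by case: ifP; rewrite ?mulr0 // mulrCA.
Qed.

Lemma contract_xiformM j c g :
  contract j (xiform c * g) = c j *: g - xiform c * contract j g.
Proof.
rewrite !mulr_suml (big_morph (contract j) (contractD j) (id1 := 0)); last first.
  by rewrite -(scale0r 0) contractZ !scale0r.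
rewrite -[c j *: g]addr0 -sumrN -(addrC 0).
have -> : 0 + c j *: g = \sum_i (c i * (i == j)%:R) *: g.
  rewrite add0r (bigD1 j) //= eqxx mulr1 big1 ?addr0 // => i /negPf ->.
  by rewrite mulr0 scale0r.
rewrite -big_split; apply: eq_bigr => i _ /=.
by rewrite -!scalerAl contractZ contract_xiM scalerBr scalerA.
Qed.

(** The anticommutation relation for linear forms.  It replaces the Leibniz rule
    of the commutative case, because only left factors are ever removed. *)
Lemma xicontract_xiformM c c' g : xicontract c (xiform c' * g) =
  (\sum_(j < n) w j * c j * c' j) *: g - xiform c' * xicontract c g.
Proof.
rewrite /xicontract scaler_suml mulr_sumr -sumrB; apply: eq_bigr => j _.
by rewrite contract_xiformM scalerBr scalerA -scalerAr.
Qed.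

Lemma xicontract1 c : xicontract c 1 = 0.
Proof. by rewrite /xicontract big1 // => j _; rewrite contract1 scaler0. Qed.

Variables (I : eqType) (u : I -> 'I_n -> A) (gam : I -> A).
Hypothesis u_orth : forall i i',
  \sum_(j < n) w j * u i j * u i' j = (i == i')%:R * gam i.

Definition ximonom (s : seq I) (t : I -> bool) : grassmann A n :=
  \prod_(i <- s) xiform (u i) ^+ t i.

Lemma xicontract_ximonom i s t : i \notin s -> xicontract (u i) (ximonom s t) = 0.
Proof.
elim: s => [|i' s IH]; rewrite /ximonom ?big_nil ?xicontract1 // big_cons.
rewrite inE negb_or -/(ximonom s t) => /andP[/negPf ni /IH h].
case: (t i'); rewrite ?expr0 ?mul1r // expr1.
by rewrite xicontract_xiformM u_orth ni mul0r scale0r h mulr0 subr0.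
Qed.

(** Exponents are 0 or 1, so each index is settled by at most one move of a factor
    across the pairing: if the other product has the same factor in front, the
    contraction removes it and yields [gam i]; otherwise it kills that product. *)
Lemma gpair_ximonom s t t' : uniq s ->
  gpair (ximonom s t) (ximonom s t')
  = \prod_(i <- s) ((t i == t' i)%:R * gam i ^+ t i).
Proof.
elim: s => [|i s IH] /=.
  rewrite /ximonom !big_nil => _; rewrite /gpair (bigD1 set0) //= big_set0.
  rewrite !gcoef_basis eqxx !mulr1 big1 ?addr0 // => S /negPf nS.
  by rewrite gcoef_basis nS !mulr0.
case/andP=> nis us; rewrite /ximonom !big_cons -/(ximonom s t) -/(ximonom s t').
case: (t i) (t' i) => [] []; rewrite ?expr0 ?expr1 ?mul1r /=.
- rewrite gpair_adj xicontract_xiformM xicontract_ximonom // mulr0 subr0.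
  by rewrite gpairZr u_orth eqxx mul1r IH.
- by rewrite gpair_adj xicontract_ximonom // gpair0r !mul0r.
- by rewrite gpairC gpair_adj xicontract_ximonom // gpair0r !mul0r.
by rewrite IH.
Qed.

End GrassmannPairing.

(** * From orthogonal columns to orthogonal rows *)

(** Orthogonality of the columns of a square matrix implies that of its rows,
    since a one-sided inverse of a square matrix is two-sided. *)
Lemma orthogonality_dual (F : fieldType) (T : finType) (P : pred T)
    (w v : T -> F) (X : T -> T -> F) :
  (forall s, P s -> v s != 0) ->
  (forall s t, P s -> P t ->
     \sum_(a | P a) w a * X a s * X a t = (s == t)%:R * v s) ->
  forall a b, P a -> P b ->
    \sum_(s | P s) X a s * X b s / v s * w b = (a == b)%:R.
Proof.
move=> v0 hX a b Pa Pb.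
pose e (i : 'I_#|P|) := enum_val i.
have Pe i : P (e i) by apply: (enum_valP i).
pose M := \matrix_(i < #|P|, j < #|P|) ((v (e i))^-1 * w (e j) * X (e j) (e i)).
pose N := \matrix_(i < #|P|, j < #|P|) X (e i) (e j).
have MN : M *m N = 1%:M.
  apply/matrixP => i j; rewrite !mxE.
  have -> : (i == j)%:R = (v (e i))^-1 * ((e i == e j)%:R * v (e i)).
    by rewrite (inj_eq enum_val_inj) mulrCA mulVf ?mulr1 ?v0.
  rewrite -hX // (big_enum_val (A := P)) big_distrr /=.
  by apply: eq_bigr => k _; rewrite !mxE -!mulrA.
have NM := mulmx1C MN.
have [i ->] : exists i, a = e i by exists (enum_rank_in Pa a); rewrite /e enum_rankK_in.
have [j ->] : exists j, b = e j by exists (enum_rank_in Pa b); rewrite /e enum_rankK_in.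
have := congr1 (fun Z : 'M_#|P| => Z i j) NM; rewrite !mxE.
rewrite (inj_eq enum_val_inj) => <-; rewrite (big_enum_val (A := P)).
apply: eq_bigr => k _; rewrite !mxE /=; ring.
Qed.

(** * Orthogonality of the rows of U *)

Section KrawtchoukData.
Variables (C : fieldType) (m : nat) (K : krawtchouk_data C m).

Lemma krawtchouk_row_pairing i i' :
  kp K 0 i * (\sum_j kpt K 0 j * kU K i j * kU K i' j) = (i == i')%:R * kp K 0 0.
Proof.
have := congr1 (fun Z : 'M_m.+1 => Z i i') (kU_orth K).
rewrite !mxE mulr_natl => <-; rewrite big_distrr /=; apply: eq_bigr => j _.
by rewrite mul_mx_diag mxE mul_diag_mx !mxE; ring.
Qed.

Lemma kp_neq0 i : kp K 0 i != 0.
Proof.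
apply/eqP => pi0; have /eqP := krawtchouk_row_pairing i i.
by rewrite pi0 mul0r eqxx mul1r eq_sym (negPf (kp0_neq0 K)).
Qed.

(** The diagonal of Pt U^T P U = p_0 I, which is the defining relation after
    moving P U to the other side as the inverse of a square matrix. *)
Lemma kpt_neq0 j : kpt K 0 j != 0.
Proof.
set p0 := kp K 0 0; have p0n : p0 != 0 := kp0_neq0 K.
have e : diag_mx (kp K) *m kU K *m (p0^-1 *: (diag_mx (kpt K) *m (kU K)^T)) = 1%:M.
  by rewrite -scalemxAr mulmxA kU_orth -mul_scalar_mx -scalar_mxM mulVf.
have := congr1 (fun Z : 'M_m.+1 => Z j j) (mulmx1C e).
rewrite -scalemxAl -mulmxA mul_diag_mx !mxE eqxx => e1; apply/eqP => q0.
by move: e1; rewrite q0 mul0r mulr0 => /eqP; rewrite eq_sym oner_eq0.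
Qed.

Lemma krawtchouk_row_orth i i' :
  \sum_j kpt K 0 j * kU K i j * kU K i' j = (i == i')%:R * (kp K 0 0 / kp K 0 i).
Proof.
apply: (mulfI (kp_neq0 i)); rewrite krawtchouk_row_pairing.
by rewrite mulrCA [_ / _]mulrC mulVKf ?kp_neq0.
Qed.

Lemma vpow_kp_neq0 b : vpow (kp K) b != 0.
Proof. by apply/prodf_neq0 => i _; rewrite expf_neq0 ?kp_neq0. Qed.

Lemma vpow_kpt_neq0 b : vpow (kpt K) b != 0.
Proof. by apply/prodf_neq0 => i _; rewrite expf_neq0 ?kpt_neq0. Qed.

Lemma prod_norm_expr b :
  \prod_i (kp K 0 0 / kp K 0 i) ^+ b i
  = kp K 0 0 ^+ (\sum_i b i)%N / vpow (kp K) b.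
Proof.
rewrite (eq_bigr (fun i => kp K 0 0 ^+ b i * (kp K 0 i ^+ b i)^-1)) => [|i _].
  by rewrite big_split /= prodfV prodrXr.
by rewrite exprMn exprVn.
Qed.

End KrawtchoukData.

(** * Orthogonality of the super Krawtchouk polynomials *)

Lemma prod_indicator (R : comNzRingType) (I : finType) (P : pred I) :
  \prod_(i : I) (P i)%:R = [forall i, P i]%:R :> R.
Proof.
case: (boolP [forall i, P i]) => [/forallP h|].
  by rewrite big1 // => i _; rewrite h.
rewrite negb_forall => /existsP[i /negPf h].
by rewrite (bigD1 i) //= h mul0r.
Qed.

Section SuperKrawtchoukFactors.
Variables (C : numFieldType) (m n : nat).
Variables (K : krawtchouk_data C m) (L : krawtchouk_data C n).
Implicit Types (a ta tb : 'X_{1..m.+1}) (e te th : {ffun 'I_n.+1 -> bool}).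

Definition xcoef a ta : C := (xmonom (kU K) (index_enum _) ta)@_a.

Definition xigen te : grassmann {mpoly C[m.+1]} n.+1 :=
  ximonom (fun i j => (kU L i j)%:MP) (index_enum _) te.

(** The coefficients of [xigen te] are constants of the polynomial ring
    ([gcoef_xigen]); this is the minor of V with rows [te] and columns [e]. *)
Definition xicoef e te : C := (gcoef (xigen te) [set i | e i])@_0%MM.

(** The odd product has degree 0 in x, by [ghomog_prod]. *)
Lemma gcoef_xigen e te : gcoef (xigen te) [set i | e i] = (xicoef e te)%:MP.
Proof.
have [h _] := ghomog_prod m L te [set i | e i].
apply/mpolyP => a; rewrite mcoeffC.
have [->|na] := eqVneq a 0%MM; first by rewrite mulr1.
by rewrite mulr0; apply: (dhomog_nemf_coeff h); rewrite /= mdeg_eq0.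
Qed.

Lemma superkrawtchouk_factor D a e ta te :
  superkrawtchouk K L D a e ta te
  = (mfact a)%:R / (D`!)%:R * (xcoef a ta * xicoef e te).
Proof.
rewrite /superkrawtchouk /genfun gcoefZ gcoef_xigen; congr (_ * _).
by rewrite mulrC mul_mpolyC mcoeffZ mulrC.
Qed.

(** The generating function is homogeneous in x and in xi separately, so the sums
    over A^(D-d,d) below may be extended to all (a, e), where they split into a
    product. *)
Lemma superkrawtchouk_eq0 D d a e ta te :
  in_Ad D d ta te -> ~~ in_Ad D d a e -> superkrawtchouk K L D a e ta te = 0.
Proof.
case/andP=> hD /eqP hd; rewrite negb_and => /orP[nA|nd].
  by rewrite /superkrawtchouk (genfun_homog K L hD nA) mulr0.
have [_ h] := ghomog_prod m L te [set i | e i].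
rewrite /superkrawtchouk gcoefZ h ?mulr0 ?mcoeff0 ?mulr0 //.
by rewrite card_edeg hd; apply/eqP.
Qed.

Lemma xcoef_orth k ta tb : (mdeg ta < k)%N ->
  \sum_(a : 'X_{1..m.+1 < k}) vpow (kpt K) (fun i => a i) * (mfact a)%:R
      * xcoef a ta * xcoef a tb
  = (ta == tb)%:R * (mfact ta)%:R
    * (kp K 0 0 ^+ mdeg ta / vpow (kp K) (fun i => ta i)).
Proof.
move=> lt.
transitivity (fischer (fun j => kpt K 0 j) k
  (xmonom (kU K) (index_enum _) ta) (xmonom (kU K) (index_enum _) tb)) => //.
rewrite (fischer_xmonom (krawtchouk_row_orth K)) ?index_enum_uniq -?mdegE //.
rewrite !big_split /= prod_norm_expr -mdegE prod_indicator /mfact natr_prod.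
congr (_%:R * _ * _); congr nat_of_bool.
by apply/forallP/eqP => [h|-> //]; apply/mnmP => i; apply/eqP.
Qed.

(** The Grassmann algebra has coefficients in C[x], so the pairing is computed
    there, and [mpolyC] being injective brings the result back to C. *)
Lemma xicoef_orth te th :
  \sum_(e : {ffun 'I_n.+1 -> bool}) vpow (kpt L) (fun i => e i) * xicoef e te * xicoef e th
  = (te == th)%:R * (kp L 0 0 ^+ edeg te / vpow (kp L) (fun i => te i)).
Proof.
apply: (can_inj (@mpolyCK m.+1 C)); rewrite raddf_sum /=.
have orth i i' : \sum_j (kpt L 0 j)%:MP * (kU L i j)%:MP * (kU L i' j)%:MP
    = (i == i')%:R * (kp L 0 0 / kp L 0 i)%:MP :> {mpoly C[m.+1]}.
  rewrite -mpolyC_nat -mpolyCM -krawtchouk_row_orth raddf_sum /=.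
  by apply: eq_bigr => j _; rewrite !mpolyCM.
have := gpair_ximonom orth te th (index_enum_uniq _).
rewrite -/(xigen te) -/(xigen th) => h.
transitivity (gpair (fun j => (kpt L 0 j)%:MP) (xigen te) (xigen th)).
  rewrite /gpair (reindex (fun e : {ffun 'I_n.+1 -> bool} => [set i | e i])) /=.
    apply: eq_bigr => e _; rewrite !gcoef_xigen !mpolyCM; congr (_ * _ * _).
    rewrite /vpow rmorph_prod [RHS]big_mkcond /=; apply: eq_bigr => i _.
    by rewrite inE; case: (e i).
  exists (fun S : {set 'I_n.+1} => [ffun i => i \in S]) => [e _|S _].
    by apply/ffunP => i; rewrite ffunE inE.
  by apply/setP => i; rewrite inE ffunE.
rewrite h -(prod_norm_expr L) big_split /= prod_indicator mpolyCM mpolyC_nat rmorph_prod /=.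
congr (_%:R * _); last by apply: eq_bigr => i _; rewrite rmorphXn.
congr nat_of_bool.
by apply/forallP/eqP => [e|-> //]; apply/ffunP => i; apply/eqP.
Qed.

Lemma superkrawtchouk_row_orth D d ta tb te th : in_Ad D d ta te ->
  \sum_(a : 'X_{1..m.+1 < D.+1}) \sum_(e : {ffun 'I_n.+1 -> bool} | in_Ad D d a e)
      vpow (kpt K) (fun i => a i) * vpow (kpt L) (fun i => e i)
      * ((D`!)%:R / (mfact a)%:R)
      * superkrawtchouk K L D a e ta te
      * superkrawtchouk K L D a e tb th
   = (ta == tb)%:R * (te == th)%:R
     * (kp K 0 0 ^+ (D - d)%N * kp L 0 0 ^+ d / (D`!)%:R)
     * ((mfact ta)%:R / (vpow (kp K) (fun i => ta i) * vpow (kp L) (fun i => te i))).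
Proof.
move=> hA; have /andP[/eqP hD /eqP hd] := hA.
have D0 : (D`!)%:R != 0 :> C := fact_neq0 C D.
have -> : (D - d)%N = mdeg ta by rewrite -hD -hd addnK.
have lt : (mdeg ta < D.+1)%N by rewrite -hD ltnS leq_addr.
transitivity ((D`!)%:R^-1 *
  ((\sum_(a : 'X_{1..m.+1 < D.+1}) vpow (kpt K) (fun i => a i) * (mfact a)%:R
      * xcoef a ta * xcoef a tb) *
   (\sum_(e : {ffun 'I_n.+1 -> bool}) vpow (kpt L) (fun i => e i) * xicoef e te * xicoef e th))).
  rewrite mulr_suml big_distrr /=; apply: eq_bigr => a _.
  rewrite big_mkcond !big_distrr /=; apply: eq_bigr => e _.
  have a0 : (mfact a)%:R != 0 :> C := mfact_neq0 C a.
  (* Outside A^(D-d,d) the coefficient product itself vanishes. *)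
  case: ifP => [_|/negbT nA].
    by rewrite !superkrawtchouk_factor; field; rewrite D0 a0.
  have := superkrawtchouk_eq0 hA nA; rewrite superkrawtchouk_factor => /eqP.
  rewrite !mulf_eq0 invr_eq0 (negPf D0) (negPf a0) /= => /orP[] /eqP ->; ring.
rewrite xcoef_orth // xicoef_orth hd.
field; by rewrite D0 !vpow_kp_neq0.
Qed.

(** The inverse norms in the first relation are, up to p_0^(D-d) q_0^d, the
    weights of the second, so [orthogonality_dual] applies. *)
Lemma superkrawtchouk_col_orth D d a b e h : in_Ad D d a e -> in_Ad D d b h ->
  \sum_(ta : 'X_{1..m.+1 < D.+1}) \sum_(te : {ffun 'I_n.+1 -> bool} | in_Ad D d ta te)
      vpow (kp K) (fun i => ta i) * vpow (kp L) (fun i => te i)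
      * ((D`!)%:R / (mfact ta)%:R)
      * superkrawtchouk K L D a e ta te
      * superkrawtchouk K L D b h ta te
   = (a == b)%:R * (e == h)%:R
     * (kp K 0 0 ^+ (D - d)%N * kp L 0 0 ^+ d / (D`!)%:R)
     * ((mfact a)%:R / (vpow (kpt K) (fun i => a i) * vpow (kpt L) (fun i => e i))).
Proof.
move=> ha hb; pose c := kp K 0 0 ^+ (D - d)%N * kp L 0 0 ^+ d; rewrite -/c.
pose T : finType := ('X_{1..m.+1 < D.+1} * {ffun 'I_n.+1 -> bool})%type.
pose P (s : T) := in_Ad D d s.1 s.2.
pose w (s : T) := vpow (kpt K) (fun i => s.1 i) * vpow (kpt L) (fun i => s.2 i)
      * ((D`!)%:R / (mfact s.1)%:R).
pose v (s : T) := c / (D`!)%:R * ((mfact s.1)%:R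
  / (vpow (kp K) (fun i => s.1 i) * vpow (kp L) (fun i => s.2 i))).
pose X (s t : T) := superkrawtchouk K L D s.1 s.2 t.1 t.2.
have c0 : c != 0 by rewrite mulf_neq0 // expf_neq0 ?kp_neq0.
have D0 : (D`!)%:R != 0 :> C := fact_neq0 C D.
have f0 f : (mfact f)%:R != 0 :> C := mfact_neq0 C f.
have v0 : forall s, P s -> v s != 0.
  by move=> s _; apply: mulf_neq0; apply: mulf_neq0; rewrite ?invr_eq0 // mulf_neq0 ?vpow_kp_neq0.
have hX : forall s t, P s -> P t ->
    \sum_(u | P u) w u * X u s * X u t = (s == t)%:R * v s.
  move=> s t Ps _; have := superkrawtchouk_row_orth t.1 t.2 Ps; rewrite pair_big_dep /= => ->.
  rewrite -mulrA -/c -/(v s) -natrM mulnb -bmeqP; congr (_%:R * _).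
have lta : (mdeg a < D.+1)%N by case/andP: ha => /eqP <- _; rewrite ltnS leq_addr.
have ltb : (mdeg b < D.+1)%N by case/andP: hb => /eqP <- _; rewrite ltnS leq_addr.
pose sa : T := (BMultinom lta, e); pose sb : T := (BMultinom ltb, h).
have := orthogonality_dual v0 hX (a := sb) (b := sa) hb ha.
rewrite -mulr_suml => h1.
have w0 : w sa != 0.
  by rewrite /w !(mulf_eq0, invr_eq0) !negb_or D0 f0 !vpow_kpt_neq0.
have -> : (a == b)%:R * (e == h)%:R = (sb == sa)%:R :> C.
  rewrite -natrM mulnb eq_sym [e == h]eq_sym.
  by rewrite -[RHS]/((_ == _) && (_ == _))%:R bmeqP.
rewrite -h1 pair_big_dep /= -/P.
transitivity (c * \sum_(s | P s) X sb s * X sa s / v s).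
  rewrite big_distrr; apply: eq_bigr => s _ /=; rewrite /v /X /=.
  by field; rewrite D0 f0 c0 !vpow_kp_neq0.
rewrite -/c /w /=; field.
by rewrite D0 f0 !vpow_kpt_neq0.
Qed.

End SuperKrawtchoukFactors.

(** * The orthogonality relations *)

Theorem theorem4p5 (R : realType) (m n D d : nat)
  (K : krawtchouk_data R[i] m) (L : krawtchouk_data R[i] n)
  (alpha talpha beta tbeta : 'X_{1..m.+1})
  (eps teps eta teta : {ffun 'I_n.+1 -> bool}) :
  in_Ad D d alpha eps -> in_Ad D d talpha teps ->
  in_Ad D d beta eta -> in_Ad D d tbeta teta ->
  (\sum_(a : 'X_{1..m.+1 < D.+1}) \sum_(e : {ffun 'I_n.+1 -> bool} | in_Ad D d a e)
      vpow (kpt K) (fun i => a i) * vpow (kpt L) (fun i => e i)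
      * ((D`!)%:R / (mfact a)%:R)
      * superkrawtchouk K L D a e talpha teps
      * superkrawtchouk K L D a e tbeta teta
   = (talpha == tbeta)%:R * (teps == teta)%:R
     * (kp K 0 0 ^+ (D - d)%N * kp L 0 0 ^+ d / (D`!)%:R)
     * ((mfact talpha)%:R
        / (vpow (kp K) (fun i => talpha i) * vpow (kp L) (fun i => teps i))))
  /\
  (\sum_(a : 'X_{1..m.+1 < D.+1}) \sum_(e : {ffun 'I_n.+1 -> bool} | in_Ad D d a e)
      vpow (kp K) (fun i => a i) * vpow (kp L) (fun i => e i)
      * ((D`!)%:R / (mfact a)%:R)
      * superkrawtchouk K L D alpha eps a e
      * superkrawtchouk K L D beta eta a e
   = (alpha == beta)%:R * (eps == eta)%:R
     * (kp K 0 0 ^+ (D - d)%N * kp L 0 0 ^+ d / (D`!)%:R)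
     * ((mfact alpha)%:R
        / (vpow (kpt K) (fun i => alpha i) * vpow (kpt L) (fun i => eps i)))).
Proof.
move=> ha hta hb _; split; first exact: superkrawtchouk_row_orth.
exact: superkrawtchouk_col_orth.
Qed.
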